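(* Let $\rho^{AB}=\frac14\big(\mathbb{I}\otimes\mathbb{I}+\vec x\cdot\vec\sigma\otimes\mathbb{I}+\mathbb{I}\otimes\vec y\cdot\vec\sigma+\sum_{i=1}^3 t_i\,\sigma_i\otimes\sigma_i\big)$ be a two-qubit density matrix, where $\vec x,\vec y\in\mathbb{R}^3$ and $T=\mathrm{diag}\{t_1,t_2,t_3\}$. Let $\mathcal R=\mathrm{span}\{T^t\vec x,\vec y\}\subseteq\mathbb{R}^3$, let $\mathcal R^\perp$ be its orthogonal complement, let $x=|\vec x|$, and let $$t_0^2=\max_{\hat e_0\in\mathcal R^\perp,\ |\hat e_0|=1}\hat e_0^{\,t}T^tT\hat e_0.$$ Then $$\min_{\{\Pi_k^B\}}S(\rho^A|\{\Pi_k^B\})\le h_2\!\left(\frac{1+\sqrt{x^2+t_0^2}}{2}\right),$$ where the minimum is over all von Neumann (projective) measurements $\{\Pi_k^B\}$ on qubit $B$. Consequently $$C(\rho^{AB})\ge S(\rho^A)-h_2\!\left(\frac{1+\sqrt{x^2+t_0^2}}{2}\right),\qquad Q(\rho^{AB})\le S(\rho^B)-S(\rho^{AB})+h_2\!\left(\frac{1+\sqrt{x^2+t_0^2}}{2}\right).$$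
   Context: $\sigma_i$ are the Pauli matrices, $\vec a\cdot\vec\sigma=\sum_i a_i\sigma_i$; $\rho^A,\rho^B$ are the reduced states and $S(\rho)=-\mathrm{Tr}(\rho\log_2\rho)$. A von Neumann measurement on $B$ is $\Pi_k^B=\frac12(\mathbb{I}\pm\hat n\cdot\vec\sigma)$ ($k=0,1$) for a unit vector $\hat n$; $p_k=\mathrm{Tr}[(\mathbb{I}\otimes\Pi_k^B)\rho^{AB}(\mathbb{I}\otimes\Pi_k^B)]$, $\rho^A_k=\mathrm{Tr}_B[(\mathbb{I}\otimes\Pi_k^B)\rho^{AB}(\mathbb{I}\otimes\Pi_k^B)]/p_k$, and $S(\rho^A|\{\Pi_k^B\})=\sum_kp_kS(\rho^A_k)$. The classical correlation is $C(\rho^{AB})=\sup_{\{\Pi_k^B\}}\{S(\rho^A)-S(\rho^A|\{\Pi_k^B\})\}$ (supremum over von Neumann measurements on $B$), the mutual information is $I(\rho^{AB})=S(\rho^A)+S(\rho^B)-S(\rho^{AB})$, and the quantum discord is $Q(\rho^{AB})=I(\rho^{AB})-C(\rho^{AB})$. $h_2(x)=-x\log_2x-(1-x)\log_2(1-x)$. *)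

(* Defs.v *)
From mathcomp Require Import all_boot all_order all_algebra.
From mathcomp Require Import complex mxtens.
From mathcomp Require Import classical_sets reals exp.

Set Implicit Arguments.
Unset Strict Implicit.
Unset Printing Implicit Defensive.

Import Order.TTheory GRing.Theory Num.Theory.
Local Open Scope ring_scope.

Section QDefs.
Variable R : realType.
Local Notation C := (R[i]).

Definition log2 (p : R) : R := ln p / ln 2.

Definition h2 (p : R) : R := - (p * log2 p) - (1 - p) * log2 (1 - p).

Definition pauli (k : 'I_3) : 'M[C]_2 :=
  \matrix_(i < 2, j < 2)
    (if val k == 0%N then (if i == j then 0 else 1)
     else if val k == 1%N then
       (if i == j then 0 else if val i == 0%N then - 'i else 'i)%C
     else (if i == j then (if val i == 0%N then 1 else -1) else 0)).

Definition dotsig (a : 'cV[R]_3) : 'M[C]_2 :=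
  \sum_(k < 3) (a k 0)%:C%C *: pauli k.

Definition rhoAB (x y t : 'cV[R]_3) : 'M[C]_(2 * 2) :=
  4^-1 *: (tensmx (1%:M : 'M[C]_2) (1%:M : 'M[C]_2)
           + tensmx (dotsig x) (1%:M : 'M[C]_2)
           + tensmx (1%:M : 'M[C]_2) (dotsig y)
           + \sum_(k < 3) (t k 0)%:C%C *: tensmx (pauli k) (pauli k)).

Definition psd n (M : 'M[C]_n) : Prop :=
  forall v : 'cV[C]_n, 0 <= ((map_mx Num.conj v)^T *m M *m v) 0 0.

Definition ptrB (M : 'M[C]_(2 * 2)) : 'M[C]_2 :=
  \matrix_(i < 2, j < 2)
    \sum_(k < 2) M (mxtens_index (i, k)) (mxtens_index (j, k)).
Definition ptrA (M : 'M[C]_(2 * 2)) : 'M[C]_2 :=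
  \matrix_(i < 2, j < 2)
    \sum_(k < 2) M (mxtens_index (k, i)) (mxtens_index (k, j)).

(* von Neumann entropy S(M) = - Tr (M log2 M) = - sum_i l_i log2 l_i over
   the eigenvalues l_i of the (Hermitian) matrix M, computed from the
   spectral decomposition of MathComp (0 log 0 = 0 since 0 * _ = 0). *)
Definition vN_entropy n (M : 'M[C]_n) : R :=
  - \sum_(i < n) (let l := complex.Re (spectral_diag M 0 i) in l * log2 l).

Definition unitv (n : 'cV[R]_3) : Prop := (n^T *m n) 0 0 = 1.

Definition vNproj (n : 'cV[R]_3) (k : 'I_2) : 'M[C]_2 :=
  2^-1 *: (1%:M + (if val k == 0%N then 1 else -1) *: dotsig n).

Definition post_state (rho : 'M[C]_(2 * 2)) (n : 'cV[R]_3) (k : 'I_2)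
  : 'M[C]_(2 * 2) :=
  tensmx (1%:M : 'M[C]_2) (vNproj n k) *m rho
         *m tensmx (1%:M : 'M[C]_2) (vNproj n k).

(* p_k (real, it is the trace of a PSD matrix) *)
Definition meas_prob (rho : 'M[C]_(2 * 2)) (n : 'cV[R]_3) (k : 'I_2) : R :=
  complex.Re (\tr (post_state rho n k)).

Definition cond_state (rho : 'M[C]_(2 * 2)) (n : 'cV[R]_3) (k : 'I_2)
  : 'M[C]_2 :=
  ((meas_prob rho n k)%:C%C)^-1 *: ptrB (post_state rho n k).

Definition cond_entropy (rho : 'M[C]_(2 * 2)) (n : 'cV[R]_3) : R :=
  \sum_(k < 2) meas_prob rho n k * vN_entropy (cond_state rho n k).

Local Open Scope classical_set_scope.

Definition class_corr (rho : 'M[C]_(2 * 2)) : R :=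
  sup [set vN_entropy (ptrB rho) - cond_entropy rho n | n in unitv].

Definition mutual_info (rho : 'M[C]_(2 * 2)) : R :=
  vN_entropy (ptrB rho) + vN_entropy (ptrA rho) - vN_entropy rho.

Definition discord (rho : 'M[C]_(2 * 2)) : R :=
  mutual_info rho - class_corr rho.

Definition min_cond_entropy (rho : 'M[C]_(2 * 2)) : R :=
  inf [set cond_entropy rho n | n in unitv].

Definition t0sq (x y t : 'cV[R]_3) : R :=
  let T := diag_mx t^T in
  sup [set (e^T *m T^T *m T *m e) 0 0 |
        e in [set e | unitv e /\ (e^T *m (T^T *m x)) 0 0 = 0
                             /\ (e^T *m y) 0 0 = 0]].

Definition vnorm (v : 'cV[R]_3) : R := Num.sqrt ((v^T *m v) 0 0).

End QDefs.

(* Main.v *)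
Require Import Defs.
From mathcomp Require Import all_boot all_order all_algebra.
From mathcomp Require Import complex mxtens ring lra.
From mathcomp Require Import boolp classical_sets reals exp.
From mathcomp Require Import topology normedtype derive.
Import Order.TTheory GRing.Theory Num.Theory numFieldNormedType.Exports.
Local Open Scope ring_scope.

(** Measuring [B] along a unit vector [n] gives the outcome [k], of sign [s],
with probability [(1 + s y.n) / 2] and leaves [A] in the qubit state with Bloch
vector [(x + s T n) / (1 + s y.n)]; a qubit state with Bloch vector [r] has
entropy [h2 ((1 + |r|) / 2)].  If [n] is orthogonal to [y] and [T^t x], both
outcomes have probability [1/2] and both Bloch vectors have squared norm
[|x|^2 + |T n|^2], so a maximizer of [|T n|] over this compact set of directions
has conditional entropy exactly the bound.  Positivity on products of
projections gives [|x + s T n| <= 1 + s y.n], so conditional entropies are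
nonnegative and the infimum and supremum over all directions are genuine. *)

Section Bloch.
Set Implicit Arguments.
Unset Strict Implicit.
Unset Printing Implicit Defensive.
Variable R : realType.
Local Notation C := (R[i]).
Implicit Types a m r v x y t n : 'cV[R]_3.

Definition bloch r : 'M[C]_2 := 2^-1 *: (1%:M + dotsig r).

(** * Pauli algebra in coordinates *)

Lemma dotE a r :
  (a^T *m r) 0 0 = a 0 0 * r 0 0 + a 1 0 * r 1 0 + a 2 0 * r 2 0.
Proof.
rewrite mxE 3!big_ord_recr big_ord0 /= !mxE add0r.
by congr (_ * _ + _ * _ + _ * _); congr (_ _ _); apply/val_inj.
Qed.

Lemma sum3 (V : zmodType) (F : 'I_3 -> V) : \sum_k F k = F 0 + F 1 + F 2.
Proof.
rewrite 3!big_ord_recr big_ord0 /= add0r.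
by congr (F _ + F _ + F _); apply/val_inj.
Qed.

Lemma sum2 (V : zmodType) (F : 'I_2 -> V) : \sum_k F k = F 0 + F 1.
Proof.
by rewrite 2!big_ord_recr big_ord0 /= add0r; congr (F _ + F _); apply/val_inj.
Qed.

Lemma det_mx22 (A : 'M[C]_2) : \det A = A 0 0 * A 1 1 - A 0 1 * A 1 0.
Proof.
rewrite (expand_det_row _ 0) sum2 /cofactor !det_mx11 !mxE /= expr0 expr1.
rewrite mul1r mulN1r mulrN; congr (_ * A _ _ - _ * A _ _); exact/val_inj.
Qed.

Lemma ord2P (P : 'I_2 -> Prop) : P 0 -> P 1 -> forall i, P i.
Proof.
move=> P0 P1 [[|[|//]] i].
  by rewrite (_ : Ordinal _ = 0)//; apply/val_inj.
by rewrite (_ : Ordinal _ = 1)//; apply/val_inj.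
Qed.

Lemma ord3P (P : 'I_3 -> Prop) : P 0 -> P 1 -> P 2 -> forall i, P i.
Proof.
move=> P0 P1 P2 [[|[|[|//]]] i].
- by rewrite (_ : Ordinal _ = 0)//; apply/val_inj.
- by rewrite (_ : Ordinal _ = 1)//; apply/val_inj.
- by rewrite (_ : Ordinal _ = 2)//; apply/val_inj.
Qed.

Lemma dotsigE a : [/\ dotsig a 0 0 = (a 2 0)%:C%C,
  dotsig a 0 1 = (a 0 0 -i* a 1 0)%C,
  dotsig a 1 0 = (a 0 0 +i* a 1 0)%C &
  dotsig a 1 1 = - (a 2 0)%:C%C].
Proof.
by split; rewrite /dotsig sum3 !mxE /=; apply/eqP;
  rewrite eq_complex /=; apply/andP; split; apply/eqP; rewrite /=; ring.
Qed.

Lemma dotsigD a r : dotsig (a + r) = dotsig a + dotsig r :> 'M[C]_2.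
Proof.
rewrite /dotsig -big_split; apply: eq_bigr => k _ /=.
by rewrite mxE rmorphD scalerDl.
Qed.

Lemma dotsigZ c u : dotsig (c *: u) = c%:C%C *: dotsig u :> 'M[C]_2.
Proof.
by rewrite /dotsig scaler_sumr; apply: eq_bigr => k _;
  rewrite mxE rmorphM scalerA.
Qed.

Lemma mxtrace_dotsig a : \tr (dotsig a) = 0 :> C.
Proof. by have [e1 _ _ e2] := dotsigE a; rewrite /mxtrace sum2 e1 e2 subrr. Qed.

Lemma mxtrace_pauli k : \tr (pauli R k) = 0.
Proof. by elim/ord3P: k; rewrite /mxtrace sum2 !mxE /= ?addr0 ?subrr. Qed.

(** Each Pauli matrix squares to 1 and distinct ones anticommute, so the mixed terms of the square
    cancel. *)
Lemma dotsig_sq a : dotsig a *m dotsig a = ((a^T *m a) 0 0)%:C%C%:M.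
Proof.
have [e00 e01 e10 e11] := dotsigE a; rewrite dotE.
apply/matrixP; apply: ord2P; apply: ord2P;
rewrite !mxE sum2 ?e00 ?e01 ?e10 ?e11 /=;
apply/eqP; rewrite eq_complex /=; apply/andP; split; apply/eqP; ring.
Qed.

Lemma mxtrace_dotsig_pauli a k : \tr (dotsig a *m pauli R k) = (2 * a k 0)%:C%C.
Proof.
have [e00 e01 e10 e11] := dotsigE a.
elim/ord3P: k; rewrite /mxtrace sum2 !mxE !sum2 ?e00 ?e01 ?e10 ?e11 !mxE /=;
apply/eqP; rewrite eq_complex /=; apply/andP; split; apply/eqP; ring.
Qed.

(** * Bloch matrices: projections, traces, spectrum and entropy *)

Lemma bloch_proj m : unitv m -> bloch m *m bloch m = bloch m.
Proof.
move=> um; rewrite /bloch -scalemxAl -scalemxAr.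
rewrite mulmxDl !mulmxDr !mul1mx !mulmx1 dotsig_sq um.
(* As (m.sigma)^2 = 1, the square of 1 + m.sigma is twice itself, and this 2 cancels one factor
   1/2. *)
rewrite [dotsig m + _]addrC -mulr2n; congr (_ *: _).
by rewrite -scalerMnr scalerMnl -(mulr_natr 2^-1) mulVf ?scale1r// pnatr_eq0.
Qed.

Lemma mxtrace_bloch r : \tr (bloch r) = 1.
Proof.
by rewrite /bloch mxtraceZ mxtraceD mxtrace1 mxtrace_dotsig addr0 mulVf// pnatr_eq0.
Qed.

Lemma mxtrace_bloch_pauli r k : \tr (bloch r *m pauli R k) = (r k 0)%:C%C.
Proof.
rewrite /bloch -scalemxAl mxtraceZ mulmxDl mul1mx mxtraceD mxtrace_pauli add0r.
by rewrite mxtrace_dotsig_pauli rmorphM rmorph_nat mulKf// pnatr_eq0.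
Qed.

Lemma bloch_herm r : map_mx Num.conj (bloch r)^T = bloch r.
Proof.
have [e00 e01 e10 e11] := dotsigE r.
apply/matrixP; apply: ord2P; apply: ord2P; rewrite !mxE ?e00 ?e01 ?e10 ?e11 /=;
rewrite rmorphM fmorphV rmorph_nat rmorphD; congr (_ * (_ + _));
rewrite /= ?rmorph0 ?rmorph1//;
apply/eqP; rewrite eq_complex /= ?oppr0 ?opprK ?eqxx//.
Qed.

Lemma det_bloch r : \det (bloch r) = ((1 - (r^T *m r) 0 0) / 4)%:C%C.
Proof.
have [e00 e01 e10 e11] := dotsigE r; rewrite dotE.
have -> : \det (bloch r) = bloch r 0 0 * bloch r 1 1 - bloch r 0 1 * bloch r 1 0.
  by rewrite det_mx22.
rewrite !mxE ?e00 ?e01 ?e10 ?e11 /=.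
have -> : 2^-1 = (2^-1)%:C%C :> C by rewrite fmorphV rmorph_nat.
apply/eqP; rewrite eq_complex /=; apply/andP; split; apply/eqP; by field.
Qed.

(* No bound on [vnorm r] is needed: [ln] vanishes on negative numbers. *)
Lemma vN_entropy_bloch r : vN_entropy (bloch r) = h2 ((1 + vnorm r) / 2).
Proof.
have bnormal : bloch r \is normalmx.
  apply: hermitian_normalmx; apply/is_hermitianmxP.
  by rewrite expr0 scale1r -[LHS]bloch_herm -map_trmx.
have /orthomx_spectralP := bnormal.
set P := spectralmx _; set sp := spectral_diag _ => E.
have Pu : P \in unitmx by exact: spectral_unit.
(* Trace and determinant are invariant under conjugation by [P], so the eigenvalues have sum 1 and
   product (1 - |r|^2) / 4. *)
have tr1 : sp 0 0 + sp 0 1 = 1.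
  rewrite -(mxtrace_bloch r) E mxtrace_mulC mulmxA mulmxV// mul1mx mxtrace_diag.
  by rewrite sum2.
have dt : sp 0 0 * sp 0 1 = ((1 - (r^T *m r) 0 0) / 4)%:C%C.
  rewrite -det_bloch E !det_mulmx mulrAC -det_mulmx mulVmx// det1 mul1r det_diag.
  by rewrite 2!big_ord_recr big_ord0 /= mul1r; congr (sp _ _ * sp _ _); apply/val_inj.
have rr0 : 0 <= (r^T *m r) 0 0 by rewrite dotE -!expr2 !addr_ge0// sqr_ge0.
have vn2 : (vnorm r) ^+ 2 = (r^T *m r) 0 0 by rewrite sqr_sqrtr.
pose p : R := (1 + vnorm r) / 2.
(* With this sum and product, the first eigenvalue is a root of X^2 - X + p (1 - p), whose roots are
   p and 1 - p. *)
have : (sp 0 0 - p%:C%C) * (sp 0 0 - (1 - p)%:C%C) = 0.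
  have -> : (sp 0 0 - p%:C%C) * (sp 0 0 - (1 - p)%:C%C)
     = (sp 0 0) * (sp 0 0 - 1) + (p * (1 - p))%:C%C.
    by rewrite !(rmorphM, rmorphB) rmorph1 /=; ring.
  have -> : sp 0 0 - 1 = - sp 0 1 by rewrite -tr1; ring.
  by rewrite mulrN dt -vn2 -rmorphN -rmorphD /= /p; congr (_%:C%C); field.
rewrite /vN_entropy -/sp sum2 /h2 -/p => /eqP; rewrite mulf_eq0 !subr_eq0.
have -> : sp 0 1 = 1 - sp 0 0 by rewrite -tr1; ring.
(* The order of the two eigenvalues is unknown, but [h2] is symmetric under exchanging p and 1 -
   p. *)
case/orP => /eqP -> /=; rewrite ?subr0.
  by rewrite opprD.
by rewrite (_ : 1 - (1 - p) = p) ?opprD 1?addrC//; ring.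
Qed.

(** * Effect of a projective measurement of B, and partial traces *)

Definition Tmul t m : 'cV[R]_3 := diag_mx t^T *m m.

Lemma TmulE t m k : Tmul t m k 0 = t k 0 * m k 0.
Proof. by rewrite /Tmul mul_diag_mx !mxE. Qed.

Lemma addTmulE x t m k : (x + Tmul t m) k 0 = x k 0 + t k 0 * m k 0.
Proof. by rewrite mxE TmulE. Qed.

(** Serves twice: with A = 1 for a measurement of B, and with two Bloch projections for testing
    positivity. *)
Lemma sandwich_rhoAB (A B : 'M[C]_2) x y t :
  tensmx A B *m rhoAB x y t *m tensmx A B =
  4^-1 *: (tensmx (A *m A) (B *m B) + tensmx (A *m dotsig x *m A) (B *m B)
    + tensmx (A *m A) (B *m dotsig y *m B)
    + \sum_k (t k 0)%:C%C *: tensmx (A *m pauli R k *m A) (B *m pauli R k *m B)).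
Proof.
rewrite /rhoAB -scalemxAr -scalemxAl !mulmxDr !mulmxDl !tensmx_mul !mulmx1.
congr (_ *: (_ + _)); rewrite mulmx_sumr mulmx_suml; apply: eq_bigr => k _.
by rewrite -scalemxAr -scalemxAl !tensmx_mul.
Qed.

Lemma ptrBD (M N : 'M[C]_(2 * 2)) : ptrB (M + N) = ptrB M + ptrB N.
Proof.
by apply/matrixP => i j; rewrite !mxE -big_split; apply: eq_bigr => k _; rewrite mxE.
Qed.

Lemma ptrBZ c (M : 'M[C]_(2 * 2)) : ptrB (c *: M) = c *: ptrB M.
Proof.
by apply/matrixP => i j; rewrite !mxE mulr_sumr; apply: eq_bigr => k _; rewrite mxE.
Qed.

Lemma ptrB_tens (A B : 'M[C]_2) : ptrB (tensmx A B) = \tr B *: A.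
Proof.
apply/matrixP => i j; rewrite !mxE mulr_suml; apply: eq_bigr => k _.
by rewrite tensmxE mulrC.
Qed.

(** Lets outcome probabilities be read off the reduced operator computed in [ptrB_post]. *)
Lemma mxtrace_ptrB (M : 'M[C]_(2 * 2)) : \tr (ptrB M) = \tr M.
Proof.
rewrite /mxtrace (reindex (@mxtens_index 2 2)) /=; last first.
  by exists (@mxtens_unindex 2 2) => k _; rewrite (mxtens_indexK, mxtens_unindexK).
under eq_bigr do rewrite mxE.
by rewrite pair_bigA; apply: eq_bigr => -[i j] _.
Qed.

Lemma mxtrace_tens (A B : 'M[C]_2) : \tr (tensmx A B) = \tr A * \tr B.
Proof. by rewrite -mxtrace_ptrB ptrB_tens mxtraceZ mulrC. Qed.

Lemma mxtrace_bloch_sandwich m (A : 'M[C]_2) : unitv m ->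
  \tr (bloch m *m A *m bloch m) = \tr (bloch m *m A).
Proof. by move=> um; rewrite mxtrace_mulC mulmxA bloch_proj. Qed.

Lemma mxtrace_bloch_dotsig m a : \tr (bloch m *m dotsig a) = ((a^T *m m) 0 0)%:C%C.
Proof.
rewrite /dotsig mulmx_sumr raddf_sum /= mxE rmorph_sum; apply: eq_bigr => k _ /=.
by rewrite -scalemxAr mxtraceZ mxtrace_bloch_pauli mxE rmorphM.
Qed.

(** With P = [bloch m], tracing out B leaves only the scalar tr (P X) of each factor P X P: it is 1
    for the identity, y.m for y.sigma, and m_k for the k-th Pauli matrix. The last ones, weighted by
    t_k, assemble into T m. *)
Lemma ptrB_post m x y t : unitv m ->
  ptrB (tensmx 1%:M (bloch m) *m rhoAB x y t *m tensmx 1%:M (bloch m)) =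
  4^-1 *: ((1 + (y^T *m m) 0 0)%:C%C *: 1%:M + dotsig (x + Tmul t m)).
Proof.
move=> um; rewrite sandwich_rhoAB ptrBZ !ptrBD !ptrB_tens !mul1mx !mulmx1 bloch_proj//.
rewrite mxtrace_bloch mxtrace_bloch_sandwich// mxtrace_bloch_dotsig !scale1r.
have -> : ptrB (\sum_k (t k 0)%:C%C *: tensmx (1%:M *m pauli R k *m 1%:M)
   (bloch m *m pauli R k *m bloch m)) = dotsig (Tmul t m).
  rewrite [LHS](big_morph _ ptrBD (id1 := 0)); last first.
    by apply/matrixP => i j; rewrite !mxE big1// => k _; rewrite mxE.
  apply: eq_bigr => k _; rewrite ptrBZ ptrB_tens mulmx1 mul1mx.
  by rewrite mxtrace_bloch_sandwich// mxtrace_bloch_pauli scalerA TmulE rmorphM.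
rewrite dotsigD rmorphD rmorph1 scalerDl scale1r.
by congr (_ *: _); rewrite !addrA; congr (_ + _); rewrite addrAC.
Qed.

(** * Positivity tested on products of projections *)

Lemma psd_mxtrace p q (M : 'M[C]_p) (Q : 'M[C]_(p, q)) :
  psd M -> 0 <= \tr (map_mx Num.conj Q^T *m M *m Q).
Proof.
move=> M0; apply: sumr_ge0 => i _.
(* Each diagonal entry is the quadratic form of [M] at a column of [Q]. *)
suff -> : (map_mx Num.conj Q^T *m M *m Q) i i
    = (map_mx Num.conj (col i Q)^T *m M *m col i Q) 0 0.
  by rewrite -map_trmx; exact: M0.
rewrite tr_col map_row -row_mul colE mulmxA -row_mul -colE [RHS]mxE.
by rewrite [RHS]mxE.
Qed.

(** Up to the factor 1/4, the right-hand side is the trace of the state sandwiched between the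
    Hermitian projections [bloch a] on A and [bloch m] on B. *)
Lemma psd_rhoAB_bloch x y t a m : psd (rhoAB x y t) -> unitv a -> unitv m ->
  0 <= 1 + (y^T *m m) 0 0 + ((x + Tmul t m)^T *m a) 0 0.
Proof.
move=> psdr ua um; have := @psd_mxtrace _ _ _ (tensmx (bloch a) (bloch m)) psdr.
rewrite trmx_tens map_mxT !bloch_herm sandwich_rhoAB !bloch_proj//.
rewrite mxtraceZ !mxtraceD !mxtrace_tens !mxtrace_bloch.
rewrite !mxtrace_bloch_sandwich// !mxtrace_bloch_dotsig.
rewrite raddf_sum /=.
under eq_bigr do rewrite mxtraceZ mxtrace_tens !mxtrace_bloch_sandwich//
  !mxtrace_bloch_pauli.
(* The positive factor 1/4 is dropped; what remains is the image of a real number, so the inequality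
   descends to [R]. *)
rewrite pmulr_rge0 ?invr_gt0 ?ltr0n// !mulr1 mul1r.
under eq_bigr do rewrite -!rmorphM.
rewrite -rmorph_sum -(rmorph1 (real_complex R)) -!rmorphD /= lecR.
congr (0 <= _); rewrite !dotE sum3 !addTmulE; ring.
Qed.

(** * Outcome probabilities and conditional states *)

Definition outcome_sign (k : 'I_2) : R := if val k == 0%N then 1 else -1.

(** Both outcomes become instances of one Bloch projection, along n or - n, so a single computation
    covers them. *)
Lemma vNprojE n k : vNproj n k = bloch (outcome_sign k *: n).
Proof.
rewrite /vNproj /bloch dotsigZ /outcome_sign.
by case: (val k == 0%N); rewrite ?rmorphN ?rmorph1.
Qed.

Lemma unitv_outcome n k : unitv n -> unitv (outcome_sign k *: n).
Proof.
rewrite /unitv !dotE !mxE => <-; rewrite /outcome_sign; case: (_ == _); ring.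
Qed.

Lemma meas_probE x y t n k : unitv n ->
  meas_prob (rhoAB x y t) n k = (1 + (y^T *m (outcome_sign k *: n)) 0 0) / 2.
Proof.
move=> un; rewrite /meas_prob /post_state -mxtrace_ptrB vNprojE.
rewrite ptrB_post; last exact: unitv_outcome.
rewrite mxtraceZ mxtraceD mxtraceZ mxtrace1 mxtrace_dotsig addr0.
have -> : 4^-1 = (4^-1)%:C%C :> C by rewrite fmorphV rmorph_nat.
by rewrite -(rmorph_nat (real_complex R)) -!rmorphM /=; field.
Qed.

(** Dividing the reduced operator of [ptrB_post] by the probability p / 2, with p = 1 + y.m,
    normalizes its identity part to 1/2 and scales the Bloch vector by 1 / p. *)
Lemma cond_stateE x y t n k : unitv n ->
  let m := outcome_sign k *: n in
  1 + (y^T *m m) 0 0 != 0 ->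
  cond_state (rhoAB x y t) n k = bloch ((1 + (y^T *m m) 0 0)^-1 *: (x + Tmul t m)).
Proof.
move=> un m nz; rewrite /cond_state meas_probE// /post_state vNprojE -/m.
rewrite ptrB_post; last exact: unitv_outcome.
rewrite /bloch dotsigZ; move: nz; set p := 1 + _ => nz.
rewrite scalerA.
have -> : (p / 2)%:C%C^-1 / 4 = 2^-1 * (p^-1)%:C%C.
  have -> : 4 = (4%:R)%:C%C :> C by rewrite rmorph_nat.
  have -> : 2 = (2%:R)%:C%C :> C by rewrite rmorph_nat.
  rewrite -!fmorphV -!rmorphM /=; congr (_%:C%C); by field.
rewrite -scalerA scalerDr scalerA -rmorphM mulVf// rmorph1 scale1r//.
Qed.

(** * Norms of Bloch vectors and conditional entropies *)

Lemma vnorm_sq r : vnorm r ^+ 2 = (r^T *m r) 0 0.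
Proof. by rewrite sqr_sqrtr// dotE -!expr2 !addr_ge0// sqr_ge0. Qed.

Lemma vnorm_ge0 r : 0 <= vnorm r.
Proof. exact: sqrtr_ge0. Qed.

Lemma dotZr c (u v : 'cV[R]_3) : (u^T *m (c *: v)) 0 0 = c * (u^T *m v) 0 0.
Proof. by rewrite -scalemxAr mxE. Qed.

Lemma dotZl c (u v : 'cV[R]_3) : ((c *: u)^T *m v) 0 0 = c * (u^T *m v) 0 0.
Proof. by rewrite linearZ -scalemxAl mxE. Qed.

Lemma vnormZ c r : 0 <= c -> vnorm (c *: r) = c * vnorm r.
Proof.
move=> c0; rewrite /vnorm dotZl dotZr mulrA -expr2 sqrtrM ?sqr_ge0// sqrtr_sqr.
by rewrite ger0_norm.
Qed.

Lemma unitv_normalize r : 0 < vnorm r -> unitv ((vnorm r)^-1 *: r).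
Proof.
move=> r0; rewrite /unitv dotZl dotZr -vnorm_sq mulrA -expr2 -exprMn mulVf ?expr1n//.
exact: lt0r_neq0.
Qed.

Lemma unitvN r : unitv r -> unitv (- r).
Proof. by rewrite /unitv !dotE !mxE => <-; ring. Qed.

(** Writing r for x + T m, the sharpest test in [psd_rhoAB_bloch] takes a = - r / |r|, where r.a = -
    |r|. *)
Lemma vnorm_post_le x y t m : psd (rhoAB x y t) -> unitv m ->
  vnorm (x + Tmul t m) <= 1 + (y^T *m m) 0 0.
Proof.
move=> psdr um; set r := x + _.
have [r0|r0] := ltrP 0 (vnorm r).
  have := psd_rhoAB_bloch psdr (unitvN (unitv_normalize r0)) um.
  rewrite -/r mulmxN [in X in _ + X]mxE dotZr -vnorm_sq expr2 mulKf ?lt0r_neq0//.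
  by rewrite subr_ge0.
(* Here r has norm 0 and gives no direction; adding the tests along [m] and [- m] yields 0 <= 1 +
   y.m. *)
have := psd_rhoAB_bloch psdr um um; have := psd_rhoAB_bloch psdr (unitvN um) um.
by rewrite mulmxN [in X in _ + X]mxE -/r => *; rewrite (le_trans r0)//; lra.
Qed.

Lemma h2_ge0 (p : R) : 0 <= p <= 1 -> 0 <= h2 p.
Proof.
have plnp (q : R) : 0 <= q <= 1 -> 0 <= - (q * log2 q).
  move=> /andP[q0 q1]; rewrite oppr_ge0 mulr_ge0_le0// /log2.
  by rewrite mulr_le0_ge0 ?ln_le0// invr_ge0 ln_ge0// ler1n.
by move=> p01; rewrite /h2 addr_ge0// plnp//; lra.
Qed.

(** By [vnorm_post_le], a possible outcome leaves a Bloch vector of norm at most 1, so its entropy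
    is [h2] at a point of [0, 1]. *)
Lemma cond_entropy_ge0 x y t n : psd (rhoAB x y t) -> unitv n ->
  0 <= cond_entropy (rhoAB x y t) n.
Proof.
move=> psdr un; apply: sumr_ge0 => k _; rewrite meas_probE//.
have um := unitv_outcome k un; set m := outcome_sign k *: n in um *.
have le := vnorm_post_le psdr um.
have p0 := le_trans (vnorm_ge0 _) le.
(* An impossible outcome has a junk conditional state, but weight 0. *)
have [->|pn0] := eqVneq (1 + (y^T *m m) 0 0) 0; first by rewrite !mul0r.
have pgt : 0 < 1 + (y^T *m m) 0 0 by rewrite lt_def pn0.
rewrite mulr_ge0 ?divr_ge0// cond_stateE// vN_entropy_bloch h2_ge0//.
have := vnorm_ge0 ((1 + (y^T *m m) 0 0)^-1 *: (x + Tmul t m)).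
have : vnorm ((1 + (y^T *m m) 0 0)^-1 *: (x + Tmul t m)) <= 1.
  by rewrite vnormZ ?invr_ge0// mulrC ler_pdivrMr// mul1r.
by move=> *; apply/andP; split; lra.
Qed.

(** The sign s of the outcome enters |x + s T n|^2 only through the cross term 2 s x.(T n), which
    vanishes because x.(T n) = n.(T^t x). *)
Lemma cond_entropy_orth x y t n : unitv n ->
  (n^T *m y) 0 0 = 0 -> (n^T *m ((diag_mx t^T)^T *m x)) 0 0 = 0 ->
  cond_entropy (rhoAB x y t) n =
  h2 ((1 + Num.sqrt (vnorm x ^+ 2
      + (n^T *m (diag_mx t^T)^T *m diag_mx t^T *m n) 0 0)) / 2).
Proof.
move=> un ny nTx.
have yn : (y^T *m n) 0 0 = 0 by rewrite -ny !dotE; ring.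
have xTn : (x^T *m Tmul t n) 0 0 = 0.
  by rewrite -nTx tr_diag_mx !dotE !TmulE; ring.
have nTTn : (n^T *m (diag_mx t^T)^T *m diag_mx t^T *m n) 0 0
    = ((Tmul t n)^T *m Tmul t n) 0 0.
  by rewrite /Tmul trmx_mul -!mulmxA.
rewrite /cond_entropy.
under eq_bigr => k _.
  rewrite meas_probE// cond_stateE// dotZr yn mulr0 addr0 ?oner_neq0//.
  rewrite invr1 scale1r vN_entropy_bloch.
  have -> : vnorm (x + Tmul t (outcome_sign k *: n)) = Num.sqrt (vnorm x ^+ 2
      + (n^T *m (diag_mx t^T)^T *m diag_mx t^T *m n) 0 0).
    rewrite vnorm_sq nTTn /vnorm; congr Num.sqrt.
    have signE j : (outcome_sign k *: n) j 0 = outcome_sign k * n j 0 by rewrite mxE.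
    move: xTn; rewrite !dotE !addTmulE !TmulE !signE /outcome_sign => xTn.
    by case: (_ == _); lra.
  over.
by rewrite sum2; field.
Qed.

(** * Existence of a maximizing direction orthogonal to T^t x and y *)

Lemma unitv_orth (u v : 'cV[R]_3) :
  exists e, [/\ unitv e, (e^T *m u) 0 0 = 0 & (e^T *m v) 0 0 = 0].
Proof.
pose A : 'M[R]_(3, 1 + 1) := row_mx u v.
(* [A] has three rows and rank at most 2, so a nonzero row vector annihilates both columns;
   normalizing it gives [e]. *)
have : kermx A != 0.
  by rewrite -mxrank_eq0 mxrank_ker subn_eq0 -ltnNge ltnS rank_leq_col.
case/rowV0Pn => w /sub_kermxP; rewrite mul_mx_row => /eqP.
rewrite -[X in _ == X]row_mx0 => /eqP /eq_row_mx [wu wv] w0.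
have wgt0 : 0 < vnorm w^T.
  rewrite lt_def vnorm_ge0 andbT; apply: contra w0 => /eqP w0.
  have := vnorm_sq w^T; rewrite w0 expr0n trmxK mxE.
  under eq_bigr do rewrite mxE -expr2.
  move=> /esym /eqP; rewrite psumr_eq0; last by move=> *; exact: sqr_ge0.
  move=> /allP z; apply/eqP/rowP => j; rewrite mxE; apply/eqP.
  by have := z j (mem_index_enum _); rewrite sqrf_eq0.
exists ((vnorm w^T)^-1 *: w^T); split; first exact: unitv_normalize.
- by rewrite dotZl trmxK wu mxE mulr0.
- by rewrite dotZl trmxK wv mxE mulr0.
Qed.

Lemma unitv_coord_le1 (e : 'cV[R]_3) i : unitv e -> `|e i 0| <= 1.
Proof.
rewrite /unitv mxE (bigD1 i)//= mxE -expr2 => e1.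
rewrite -(@expr_le1 _ 2)// real_normK ?num_real// -e1 lerDl.
by apply: sumr_ge0 => j _; rewrite mxE -expr2 sqr_ge0.
Qed.

Local Open Scope classical_set_scope.

Lemma continuous_dot (f g : 'rV[R]_3 -> 'cV[R]_3) :
  (forall i, continuous (fun w => f w i 0 : R)) ->
  (forall i, continuous (fun w => g w i 0 : R)) ->
  continuous (fun w => ((f w)^T *m g w) 0 0 : R).
Proof.
move=> cf cg.
rewrite (_ : (fun w => _) = fun w =>
  f w 0 0 * g w 0 0 + f w 1 0 * g w 1 0 + f w 2 0 * g w 2 0 : R); last first.
  by apply/funext => w; rewrite dotE.
have cfg i : continuous (fun w => f w i 0 * g w i 0 : R).
  by move=> w; exact: cvgM (cf i w) (cg i w).
by move=> w; exact: cvgD (cvgD (cfg 0 w) (cfg 1 w)) (cfg 2 w).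
Qed.

(** The admissible directions form a nonempty compact set on which |T e|^2 is continuous. They are
    transposed to row vectors so that [rV_compact] and [EVT_max_rV] apply. *)
Lemma t0sq_attained x y t : exists e, [/\ unitv e,
  (e^T *m ((diag_mx t^T)^T *m x)) 0 0 = 0, (e^T *m y) 0 0 = 0 &
  t0sq x y t = (e^T *m (diag_mx t^T)^T *m diag_mx t^T *m e) 0 0].
Proof.
set T := diag_mx t^T; set Tx := T^T *m x.
pose q (e : 'cV[R]_3) : R := (e^T *m T^T *m T *m e) 0 0.
pose S := [set e : 'cV[R]_3 | unitv e /\ (e^T *m Tx) 0 0 = 0 /\ (e^T *m y) 0 0 = 0].
pose A := [set w : 'rV[R]_3 | S w^T].
have qE e : q e = ((Tmul t e)^T *m Tmul t e) 0 0.
  by rewrite /q /Tmul trmx_mul -!mulmxA.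
have ctr i : continuous (fun w : 'rV[R]_3 => w^T i 0 : R).
  rewrite (_ : (fun w => _) = fun w : 'rV[R]_3 => w 0 i); first exact: coord_continuous.
  by apply/funext => w; rewrite mxE.
have ccst (v : 'cV[R]_3) i : continuous (fun w : 'rV[R]_3 => v i 0 : R).
  exact: cst_continuous.
have Acl : closed A.
  have -> : A = (fun w : 'rV[R]_3 => (w^T^T *m w^T) 0 0 : R) @^-1` [set 1] `&`
     ((fun w : 'rV[R]_3 => (w^T^T *m Tx) 0 0 : R) @^-1` [set 0] `&`
      (fun w : 'rV[R]_3 => (w^T^T *m y) 0 0 : R) @^-1` [set 0]) by [].
  have dot_closed (v : 'rV[R]_3 -> 'cV[R]_3) c :
      (forall i, continuous (fun w => v w i 0 : R)) ->
      closed ((fun w : 'rV[R]_3 => (w^T^T *m v w) 0 0 : R) @^-1` [set c]).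
    move=> cv; apply: preimage_closed; last exact: closed_eq.
    by move=> w _; exact: continuous_dot.
  by apply: closedI; [|apply: closedI]; apply: dot_closed.
have Acpt : compact A.
  (* The unit sphere lies in the cube [-1, 1]^3, a product of compact segments. *)
  have box : compact [set v : 'rV[R]_3 | forall i, `[(-1 : R), 1] (v ord0 i)].
    by apply: (@rV_compact R 3 (fun=> `[(-1 : R), 1])) => _; exact: segment_compact.
  apply: subclosed_compact Acl box _ => w [uw _] i.
  by have := unitv_coord_le1 i uw; rewrite mxE ler_norml /= in_itv.
have A0 : A !=set0.
  have [e [ue eTx ey]] := unitv_orth Tx y.
  by exists e^T; rewrite /A /S /= trmxK.
have cq : continuous (fun w : 'rV[R]_3 => q w^T).
  rewrite (_ : (fun w => _) =
    fun w : 'rV[R]_3 => ((Tmul t w^T)^T *m Tmul t w^T) 0 0 : R); last first.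
    by apply/funext => w; rewrite qE.
  have cT i : continuous (fun w : 'rV[R]_3 => Tmul t w^T i 0 : R).
    rewrite (_ : (fun w => _) = fun w : 'rV[R]_3 => t i 0 * w^T i 0 : R).
      by move=> w; exact: cvgM (ccst t i w) (ctr i w).
    by apply/funext => w; rewrite TmulE.
  exact: continuous_dot.
have [w wA wmax] := EVT_max_rV A0 Acpt (continuous_subspaceT cq).
have {}wA : A w by rewrite inE in wA.
have [uw [wTx wy]] := wA.
exists w^T; split => //; apply/eqP; rewrite eq_le; apply/andP; split.
  (* The maximum is an upper bound, hence at least the supremum; being a value of the set, it is
     also at most the supremum. *)
  apply: ge_sup; first by exists (q w^T), w^T.
  move=> _ [e Se <-]; rewrite -/(q e) -[e]trmxK; apply: wmax.
  by rewrite inE /A /= trmxK.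
apply: ub_le_sup; last by exists w^T.
exists (q w^T) => _ [e Se <-]; rewrite -/(q e) -[e]trmxK; apply: wmax.
by rewrite inE /A /= trmxK.
Qed.

End Bloch.

Theorem theorem1 (R : realType) (x y t : 'cV[R]_3) :
  psd (rhoAB x y t) ->
  let rho := rhoAB x y t in
  let b := h2 ((1 + Num.sqrt (vnorm x ^+ 2 + t0sq x y t)) / 2) in
  [/\ min_cond_entropy rho <= b,
      vN_entropy (ptrB rho) - b <= class_corr rho
    & discord rho <= vN_entropy (ptrA rho) - vN_entropy rho + b].
Proof.
move=> psdr rho b.
have [e [ue eTx ey t0E]] := t0sq_attained x y t.
have be : cond_entropy rho e = b by rewrite /b t0E; exact: cond_entropy_orth.
have corr : vN_entropy (ptrB rho) - b <= class_corr rho.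
  apply: ub_le_sup; last by exists e => //; rewrite be.
  (* The set must be bounded above for [sup] to dominate its elements; S(rho^A) is a bound since
     conditional entropies are nonnegative. *)
  exists (vN_entropy (ptrB rho)) => _ [n un <-].
  by rewrite gerBl; exact: cond_entropy_ge0.
split=> //.
- rewrite -be; apply: ge_inf; last by exists e.
  by exists 0 => _ [n un <-]; exact: cond_entropy_ge0.
(* The discord is S(rho^B) - S(rho^AB) + (S(rho^A) - C), and [corr] bounds the bracket by [b]. *)
- by rewrite /discord /mutual_info; lra.
Qed.
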